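(* There exists an absolute constant $c>0$ such that for every real $\rho\ge c$ there exists a countable metric space $(X,d)$ with Assouad dimension $\dim_A(X)=\rho$ such that no deterministic online algorithm achieves a finite competitive ratio in the nested ball chasing problem over $X$; that is, $R(X)=\hat R(X)=\infty$.
   Context: Assouad dimension: for a metric space $(X,d)$ and $E\subseteq X$, let $N_r(E)$ be the smallest number of open balls of $X$ with radius at most $r$ that cover $E$. The Assouad dimension $\dim_A(X)$ is the infimum of all $s\ge0$ for which there is a constant $C>0$ such that $N_r(B(x,R))\le C(R/r)^s$ for all $0<r<R$ and all $x\in X$, where $B(x,R)=\{y\in X:d(x,y)<R\}$ is the open ball. Ball chasing over $(X,d)$: an online player starts at a point $x_0\in X$. At each time $t=1,\dots,T$ ($T\in\mathbb{N}$ finite, not known in advance) a closed ball $B_t=\bar B(z,r)=\{y\in X:d(z,y)\le r\}$, for some $z\in X$, $r\ge0$, is revealed. A deterministic online algorithm $\mathcal{A}$ chooses $x_t\in B_t$ as a function of $x_0,B_1,\dots,B_t$ only. Its cost is $\sum_{t=1}^T d(x_t,x_{t-1})$, and the offline optimum is $\inf\{\sum_{t=1}^T d(y_t,y_{t-1}): y_t\in B_t\ \forall t,\ y_0=x_0\}$. The competitive ratio $C(\mathcal{A})\in[0,\infty]$ is the supremum of cost divided by offline optimum over all starting points $x_0\in X$, all $T$, and all request sequences (conventions: $0/0=0$, $a/0=\infty$ for $a>0$). $R(X)$ is the infimum of $C(\mathcal{A})$ over all deterministic online algorithms. In the nested ball chasing problem only sequences with $B_1\supseteq B_2\supseteq\dots\supseteq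 B_T$ are allowed, and $\hat R(X)$ is the corresponding infimum of competitive ratios. *)

(* Defs.v *)
From HB Require Import structures.
From mathcomp Require Import all_boot all_order all_algebra.
From mathcomp Require Import all_classical all_reals.
From mathcomp Require Import ereal topology exp.

Set Implicit Arguments.
Unset Strict Implicit.
Unset Printing Implicit Defensive.

Import Order.TTheory GRing.Theory Num.Theory.

Local Open Scope classical_set_scope.
Local Open Scope ring_scope.

Section AssouadDimension.
Context {R : realType} {X : metricType R}.

Definition covered_by (E : set X) (r : R) (n : nat) : Prop :=
  exists (c : 'I_n -> X) (rad : 'I_n -> R),
    (forall i, 0 < rad i <= r) /\
    E `<=` [set y | exists i, ball (c i) (rad i) y].

(* Equal to +oo when no finite cover exists. *)
Definition covering_number (r : R) (E : set X) : \bar R :=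
  ereal_inf [set (n%:R)%:E | n in [set n | covered_by E r n]].

Definition assouad_bound (s : R) : Prop :=
  exists2 C : R, 0 < C &
    forall (x : X) (r r' : R), 0 < r -> r < r' ->
      (covering_number r (ball x r') <= (C * (r' / r) `^ s)%:E)%E.

End AssouadDimension.

Definition assouad_dim {R : realType} (X : metricType R) : \bar R :=
  ereal_inf [set s%:E | s in [set s : R | 0 <= s /\ assouad_bound (X := X) s]].

Section BallChasing.
Context {R : realType} {X : metricType R}.

(* Not the library's [closed_ball], which is the closure of the open ball and
   may be strictly smaller in a general metric space. *)
Definition cball (z : X) (r : R) : set X := [set y | mdist z y <= r].

(* [Bs] lists B_1, ..., B_T, so that B_(t+1) is [nth set0 Bs t]. *)
Definition ball_requests (Bs : seq (set X)) : Prop :=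
  forall t, (t < size Bs)%N ->
    exists (z : X) (r : R), 0 <= r /\ nth set0 Bs t = cball z r.

Definition nested_requests (Bs : seq (set X)) : Prop :=
  ball_requests Bs /\
  forall t, (t.+1 < size Bs)%N -> nth set0 Bs t.+1 `<=` nth set0 Bs t.

(* [A x0 [:: B_1; ...; B_t]] is the position x_t chosen at time t >= 1; the
   value on the empty sequence is never used. *)
Definition strategy := X -> seq (set X) -> X.

Definition positions (A : strategy) (x0 : X) (Bs : seq (set X)) (t : nat) : X :=
  if t is 0 then x0 else A x0 (take t Bs).

Definition feasible (x0 : X) (Bs : seq (set X)) (y : nat -> X) : Prop :=
  y 0%N = x0 /\ forall t, (t < size Bs)%N -> nth set0 Bs t (y t.+1).

Definition movement (T : nat) (y : nat -> X) : R :=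
  \sum_(t < T) mdist (y t.+1) (y t).

Definition alg_cost (A : strategy) (x0 : X) (Bs : seq (set X)) : R :=
  movement (size Bs) (positions A x0 Bs).

Definition offline_opt (x0 : X) (Bs : seq (set X)) : R :=
  inf [set movement (size Bs) y | y in [set y | feasible x0 Bs y]].

(* [adm] is the collection of request sequences allowed in the problem. *)
Definition online_algorithm (adm : seq (set X) -> Prop) (A : strategy) : Prop :=
  forall x0 Bs, adm Bs -> feasible x0 Bs (positions A x0 Bs).

(* In [\bar R], 0^-1 = +oo and 0 * +oo = 0, so that 0 / 0 = 0 and
   a / 0 = +oo for a > 0. *)
Definition competitive_ratio (adm : seq (set X) -> Prop) (A : strategy)
    : \bar R :=
  ereal_sup [set ((alg_cost A q.1 q.2)%:E / (offline_opt q.1 q.2)%:E)%E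
            | q in [set q : X * seq (set X) | adm q.2]].

Definition opt_competitive_ratio (adm : seq (set X) -> Prop) : \bar R :=
  ereal_inf [set competitive_ratio adm A | A in [set A | online_algorithm adm A]].

End BallChasing.

Definition chasing_ratio {R : realType} (X : metricType R) : \bar R :=
  opt_competitive_ratio (@ball_requests R X).

Definition nested_chasing_ratio {R : realType} (X : metricType R) : \bar R :=
  opt_competitive_ratio (@nested_requests R X).

(* Main.v *)
Require Import Defs.
From HB Require Import structures.
From mathcomp Require Import all_boot all_order all_algebra.
From mathcomp Require Import all_classical all_reals.
From mathcomp Require Import ereal topology exp.
From mathcomp Require Import zify ring lra.

Set Implicit Arguments.
Unset Strict Implicit.
Unset Printing Implicit Defensive.

Import Order.TTheory GRing.Theory Num.Theory.

Local Open Scope classical_set_scope.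
Local Open Scope ring_scope.

(** Take X = nat with d(u,v) = b^l(u,v) + [u ~ v] for u != v, where
    b = 2^(1/rho), l(u,v) is the least l such that u and v agree after deleting
    their l lowest binary digits, and ~ is the Rado graph: u ~ v iff bit u of v
    or bit v of u is set. Up to bounded factors d is the ultrametric b^l, whose
    balls of radius b^l contain 2^l = (b^l)^rho points, so the Assouad dimension
    is rho. If 2^K <= z < 2^(K+1), all points v < 2^K are at ultrametric
    distance b^(K+1) from z, and the closed ball of that radius about z omits
    exactly those v for which bit v of z is set. So every subset of {0,...,K}
    can be removed by a ball with a far away centre. The adversary confines the
    player to the 2^m points below 2^m, a cluster of diameter at most b^m + 1
    and isolated by an arbitrarily large distance, and then removes the visited
    points one after another: the player pays about 2^m, whereas moving to the
    last surviving point costs at most b^m + 1, and b < 2. *)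

Lemma exprn_unbounded (R : realType) (x y : R) : 1 < x ->
  exists n, y < x ^+ n.
Proof.
move=> x1; have x10 : 0 < x - 1 by rewrite subr_gt0.
have bernoulli n : 1 + n%:R * (x - 1) <= x ^+ n.
  elim: n => [|n IHn]; first by rewrite mul0r addr0.
  rewrite exprS; have := ler_wpM2l (ltW (lt_trans ltr01 x1)) IHn.
  apply: le_trans; rewrite -natr1 -subr_ge0.
  by have -> : x * (1 + n%:R * (x - 1)) - (1 + (n%:R + 1) * (x - 1))
     = n%:R * (x - 1) ^+ 2; [ring | rewrite mulr_ge0// sqr_ge0].
exists (Num.truncn (y / (x - 1))).+1.
apply: lt_le_trans (bernoulli _); apply: ltr_wpDl => //.
by rewrite -ltr_pdivrMr// truncnS_gt.
Qed.

(** * Binary digits and the ultrametric scale on natural numbers *)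

Section Scale.
Local Open Scope nat_scope.
Implicit Types u v w z k p : nat.

Lemma ex_scale u v : exists k, u %/ 2 ^ k == v %/ 2 ^ k.
Proof.
exists (u + v); have small n : n <= u + v -> n %/ 2 ^ (u + v) = 0.
  by move=> le_n; rewrite divn_small// (leq_ltn_trans le_n)// ltn_expl.
by rewrite !small// ?leq_addr ?leq_addl.
Qed.

Definition scale u v : nat := ex_minn (ex_scale u v).

Lemma scale_le u v k : (scale u v <= k) = (u %/ 2 ^ k == v %/ 2 ^ k).
Proof.
rewrite /scale; case: ex_minnP => m /eqP eq_m min_m.
apply/idP/idP => [le_mk|]; last exact: min_m.
by rewrite -(subnKC le_mk) expnD !divnMA eq_m.
Qed.

Lemma scale_sym u v : scale u v = scale v u.
Proof.
have le_sym a b : scale a b <= scale b a by rewrite scale_le eq_sym -scale_le.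
by apply/eqP; rewrite eqn_leq !le_sym.
Qed.

Lemma scale_eq0 u v : (scale u v == 0) = (u == v).
Proof. by rewrite -leqn0 scale_le expn0 !divn1. Qed.

Lemma scale_ultra u v w : scale u w <= maxn (scale u v) (scale v w).
Proof.
set k := maxn _ _; rewrite scale_le; apply/eqP.
transitivity (v %/ 2 ^ k); apply/eqP; rewrite -scale_le.
  exact: leq_maxl.
exact: leq_maxr.
Qed.

Lemma scale_ge u v k : u < 2 ^ k <= v -> k < scale u v.
Proof.
case/andP=> ltuk levk; rewrite ltnNge scale_le divn_small// eq_sym.
by rewrite -lt0n divn_gt0// expn_gt0.
Qed.

Lemma scale_le_small u v k : u < 2 ^ k -> v < 2 ^ k -> scale u v <= k.
Proof. by move=> ltu ltv; rewrite scale_le !divn_small. Qed.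

Definition bit z p : bool := odd (z %/ 2 ^ p).

Lemma bit_small z p : z < 2 ^ p -> bit z p = false.
Proof. by move=> ltz; rewrite /bit divn_small. Qed.

(** Binary digits can be prescribed freely; this supplies the centre of each request. *)
Lemma bitsP (S : pred nat) k :
  exists2 z, z < 2 ^ k & forall p, p < k -> bit z p = S p.
Proof.
elim: k S => [|k IHk] S; first by exists 0.
have [z ltz bitz] := IHk ((fun p => S p.+1)).
exists (S 0 + z.*2); first by rewrite expnS; case: (S 0); lia.
case=> [|p] ltp; first by rewrite /bit expn0 divn1 oddD odd_double addbF oddb.
rewrite /bit expnS divnMA -bitz//.
by congr (odd (_ %/ _)); case: (S 0); lia.
Qed.

End Scale.

(** * The perturbed ultrametric space *)

Definition rado u v : bool := bit u v || bit v u.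

(** The alias carries [b] and [b1], so that each base has its own canonical metric on [nat]. *)
Definition rado_nat (R : realType) (b : R) (b1 : 1 < b) : Type := nat.

Section RadoMetric.
Context {R : realType} (b : R) (b1 : 1 < b).
Implicit Types u v w : nat.

Definition rado_dist u v : R :=
  if u == v then 0 else b ^+ scale u v + (rado u v)%:R.

Let b0 : 0 < b := lt_trans ltr01 b1.

Lemma rado_distxx u : rado_dist u u = 0.
Proof. by rewrite /rado_dist eqxx. Qed.

Lemma rado_dist_sym u v : rado_dist u v = rado_dist v u.
Proof. by rewrite /rado_dist eq_sym scale_sym /rado orbC. Qed.

Lemma rado_dist_ge u v : u != v -> b ^+ scale u v <= rado_dist u v.
Proof. by move=> /negbTE neq; rewrite /rado_dist neq lerDl ler0n. Qed.

Lemma rado_dist_le u v : rado_dist u v <= b ^+ scale u v + 1.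
Proof.
rewrite /rado_dist; case: eqP => _; last by rewrite lerD2l lern1 leq_b1.
by rewrite addr_ge0// exprn_ge0// ltW.
Qed.

Lemma rado_dist_ge1 u v : u != v -> 1 <= rado_dist u v.
Proof. by move/rado_dist_ge; apply: le_trans; rewrite exprn_ege1// ltW. Qed.

Lemma rado_dist_eq0 u v : rado_dist u v = 0 -> u = v.
Proof.
move=> duv; apply/eqP/negPn/negP => /rado_dist_ge1.
by rewrite duv ler10.
Qed.

(* The scale term is an ultrametric with values at least 1, hence it leaves
   room for an arbitrary symmetric perturbation with values in [0, 1]. *)
Lemma rado_dist_triangle v u w :
  rado_dist u w <= rado_dist u v + rado_dist v w.
Proof.
have [<-|neq_uv] := eqVneq u v; first by rewrite rado_distxx add0r.
have [<-|neq_vw] := eqVneq v w; first by rewrite rado_distxx addr0.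
apply: le_trans (rado_dist_le u w) _.
have := scale_ultra u v w; rewrite leq_max => /orP[] le_s.
- rewrite lerD ?rado_dist_ge1//.
  by rewrite (le_trans _ (rado_dist_ge neq_uv))// ler_weXn2l// ltW.
- rewrite addrC lerD ?rado_dist_ge1//.
  by rewrite (le_trans _ (rado_dist_ge neq_vw))// ler_weXn2l// ltW.
Qed.

HB.instance Definition _ := Choice.copy (rado_nat b1) nat.
HB.instance Definition _ := @isMetric.Build R (rado_nat b1) rado_dist
  rado_distxx rado_dist_eq0 rado_dist_sym rado_dist_triangle.

Let X : metricType R := rado_nat b1.

Lemma mdist_rado (u v : X) : mdist u v = rado_dist u v.
Proof. by []. Qed.

Lemma ball_rado (u v : X) r : ball u r v = (rado_dist u v < r) :> Prop.
Proof. by rewrite ballEmdist. Qed.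

End RadoMetric.

(** * The Assouad dimension is [rho] *)

Section RadoAssouad.
Context {R : realType} (b : R) (b1 : 1 < b).
Context (rho : R) (rho0 : 0 < rho) (b_rho : b `^ rho = 2).

Let X : metricType R := rado_nat b1.
Let b0 : 0 < b := lt_trans ltr01 b1.

Let bX_rho n : (b ^+ n) `^ rho = (2 ^ n)%:R.
Proof. by rewrite -powR_mulrn ?ltW// powRAC b_rho powR_mulrn// natrX. Qed.

(** The alternative [k = 0] accounts for [y < 1]. *)
Lemma expr_bracket (y : R) :
  exists k, y < b ^+ k.+1 /\ (k = 0%N \/ b ^+ k <= y).
Proof.
have ex_n : exists n, y < b ^+ n by exact: exprn_unbounded.
case: (ex_minnP ex_n) => -[|k] lt_y min_n.
  by exists 0%N; split; [rewrite (lt_trans lt_y)// expr0 expr1 | left].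
exists k; split=> //; right; rewrite leNgt; apply/negP => /min_n.
by rewrite ltnn.
Qed.

(** A ball of radius [r'] lies in one dyadic block of length [2 ^ N]. This block splits into
    [2 ^ (N - k)] blocks of length [2 ^ k], each inside a ball of radius [r]. *)
Lemma rado_assouad_bound : assouad_bound (X := X) rho.
Proof.
exists ((3 * b) `^ rho) => [|x r r' r0 rr'].
  by rewrite powR_gt0 ?mulr_gt0.
have r'0 : 0 < r' := lt_trans r0 rr'.
have [K [ltK geK]] := expr_bracket r'.
(* The factor 3 absorbs the perturbation: if [k > 0], then b^k + 1 <= 2 b^k <= 2r/3 < r. If [k = 0],
   the small blocks are single points. *)
have [k [ltk gek]] := expr_bracket (r / 3).
pose N := maxn K k; have lekN : (k <= N)%N := leq_maxr _ _.
apply: (@le_trans _ _ (2 ^ (N - k))%:R%:E).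
  apply: ereal_inf_lbound; exists (2 ^ (N - k))%N => //=.
  exists (fun j : 'I_(2 ^ (N - k)) => (x %/ 2 ^ N * 2 ^ N + j * 2 ^ k)%N : X).
  exists (fun=> r); split=> [_|y]; first by rewrite r0 lexx.
  rewrite ball_rado => lt_xy.
  have /eqP eqN : (x %/ 2 ^ N == y %/ 2 ^ N)%N.
    rewrite -scale_le; have [->|neq_xy] := eqVneq x y.
      by have /eqP -> : scale y y == 0%N by rewrite scale_eq0.
    rewrite (leq_trans _ (leq_maxl _ _))// -ltnS -(ltr_eXn2l b1).
    by rewrite (le_lt_trans (rado_dist_ge b neq_xy))// (lt_trans lt_xy).
  have ltj : (y %% 2 ^ N %/ 2 ^ k < 2 ^ (N - k))%N.
    by rewrite ltn_divLR ?expn_gt0// -expnD subnK// ltn_mod expn_gt0.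
  exists (Ordinal ltj) => /=; rewrite ball_rado eqN; set c := addn _ _.
  have le_cy : (scale c y <= k)%N.
    have eN : (2 ^ N = 2 ^ (N - k) * 2 ^ k)%N by rewrite -expnD subnK.
    have -> : scale c y = scale c (y %/ 2 ^ N * 2 ^ N + y %% 2 ^ N)%N.
      by rewrite -divn_eq.
    rewrite scale_le /c; set q := (y %/ _)%N; set i := (y %% _)%N.
    by rewrite eN mulnA -mulnDl mulnK ?divnMDl ?expn_gt0.
  have [->|neq_cy] := eqVneq c y; first by rewrite rado_distxx.
  have k0 : k <> 0%N.
    by move=> k0; move: le_cy; rewrite k0 leqn0 scale_eq0 (negbTE neq_cy).
  case: gek => // gek; apply: le_lt_trans (rado_dist_le b1 _ _) _.
  have := ler_weXn2l (ltW b1) le_cy; have := exprn_ege1 k (ltW b1).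
  by move: gek r0; lra.
have [r_ge0 r'_ge0] : 0 <= r /\ 0 <= r' by rewrite !ltW.
have b_ge0 : 0 <= b := ltW b0.
rewrite lee_fin -bX_rho -powRM ?divr_ge0 ?mulr_ge0//.
apply: ge0_ler_powR; rewrite ?nnegrE ?exprn_ge0 ?mulr_ge0 ?invr_ge0 ?(ltW rho0)//.
(* If [K <= k], one ball suffices and r < r' is enough. Otherwise [K > 0], and r < 3 b^(k+1) and b^K
   <= r' combine. *)
rewrite mulrA ler_pdivlMr//; have [leKk|ltkK] := leqP K k.
  rewrite /N (maxn_idPr leKk) subnn expr0 mul1r.
  have : r' <= b * r' by rewrite ler_peMl ?ltW.
  by move: rr' r'0; lra.
have K0 : K <> 0%N by case: (K) ltkK.
case: geK => // geK; rewrite /N (maxn_idPl (ltnW ltkK)).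
apply: (@le_trans _ _ (b ^+ (K - k) * (3 * b ^+ k.+1))).
  rewrite ler_wpM2l ?exprn_ge0 ?(ltW b0)//.
  by move: ltk; lra.
rewrite mulrCA -exprD addnS subnK 1?ltnW// exprS !mulrA.
by rewrite ler_wpM2l// mulr_ge0// ltW.
Qed.

(** Distinct points are at distance at least 1, so an open ball of radius at most 1 contains only
    its centre. *)
Lemma covered_by_unit_balls (E : set X) (r : R) (n m : nat) : r <= 1 ->
  (forall u : X, (u < m)%N -> E u) -> covered_by E r n -> (m <= n)%N.
Proof.
move=> r1 subE [c [rad [rad_r /= covE]]].
have ex_i (u : 'I_m) : {i | ball (c i) (rad i) (u : nat)}.
  by apply/cid/covE/subE/ltn_ord.
pose f u := sval (ex_i u).
suff inj_f : injective f by have := leq_card f inj_f; rewrite !card_ord.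
have c_f u : c (f u) = u :> nat.
  apply/eqP/negPn/negP => /(rado_dist_ge1 b1).
  have := svalP (ex_i u); rewrite ball_rado leNgt -/(f u) => lt_u /negP; apply.
  by apply: lt_le_trans lt_u _; have /andP[_] := rad_r (f u); move/le_trans; apply.
by move=> u v fuv; apply: val_inj; rewrite /= -!c_f fuv.
Qed.

(** The ball of radius 3 b^n about 0 contains the 2^n points below 2^n, hence needs 2^n unit balls.
    If s < rho, then b^s < 2 and C 3^s (b^s)^n is eventually smaller. *)
Lemma rado_assouad_bound_ge s : 0 <= s -> assouad_bound (X := X) s -> rho <= s.
Proof.
move=> s0 [C C0 bnd]; rewrite leNgt; apply/negP => lt_s.
have bs0 : 0 < b `^ s by rewrite powR_gt0.
have bs2 : b `^ s < 2.
  rewrite -b_rho -(subrK s rho) powRD ?(gt_eqF b0) ?implybT// ltr_pMl//.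
  have rho_s0 : 0 < rho - s by rewrite subr_gt0.
  have := gt0_ltr_powR rho_s0 _ _ b1.
  by rewrite powR1; apply; rewrite nnegrE ltW.
have [|n ltn] := @exprn_unbounded R (2 / b `^ s) (C * 3 `^ s).
  by rewrite ltr_pdivlMr// mul1r.
have := bnd (0%N : X) 1 (3 * b ^+ n) ltr01.
have bn1 := exprn_ege1 n (ltW b1).
have -> : 1 < 3 * b ^+ n by move: bn1; lra.
move=> /(_ isT); apply/negP; rewrite -ltNge.
apply: (@lt_le_trans _ _ (2 ^ n)%:R%:E).
  rewrite lte_fin divr1 powRM ?exprn_ge0 ?(ltW b0)// mulrA.
  rewrite -[b ^+ n]powR_mulrn ?(ltW b0)// powRAC powR_mulrn ?powR_ge0//.
  by rewrite natrX -ltr_pdivlMr ?exprn_gt0// -expr_div_n.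
apply: le_ereal_inf_tmp => _ [m /= cov_m <-]; rewrite lee_fin ler_nat.
apply: (covered_by_unit_balls (lexx 1)) cov_m => u ltu.
rewrite ball_rado; apply: le_lt_trans (rado_dist_le b1 _ _) _.
have := ler_weXn2l (ltW b1) (scale_le_small (expn_gt0 2 n) ltu).
by move: bn1; lra.
Qed.

Lemma rado_assouad_dim : assouad_dim X = rho%:E.
Proof.
apply/eqP; rewrite eq_le; apply/andP; split.
  apply: ereal_inf_lbound; exists rho => //; split; first exact: ltW.
  exact: rado_assouad_bound.
apply: le_ereal_inf_tmp => _ [s [s0 bnd] <-]; rewrite lee_fin.
exact: rado_assouad_bound_ge.
Qed.

End RadoAssouad.

(** * The nested adversary and the unbounded competitive ratio *)

Section RadoChasing.
Context {R : realType} (b : R) (b1 : 1 < b).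

Let X : metricType R := rado_nat b1.
Let b0 : 0 < b := lt_trans ltr01 b1.

Section Adversary.
Context (m a : nat) (le_ma : (m <= a)%N).
Let K := (2 ^ a)%N.

(** The points strictly between [K] and 2^(K+1) stay in every request; the player may escape there,
    but only at cost at least b^(a+1) from the cluster. *)
Definition unvisited (visited : seq nat) : set X :=
  [set v | (v < 2 ^ K.+1)%N /\
           ((v <= K)%N -> (v < 2 ^ m)%N /\ v \notin visited)].

Lemma unvisited_cball visited :
  exists z : X, unvisited visited = cball z (b ^+ K.+1).
Proof.
have le_mK : (2 ^ m <= K)%N by rewrite leq_exp2l.
have [z ltz bitz] := bitsP (fun p => (2 ^ m <= p)%N || (p \in visited)) K.+1.
(* Digit [K] of [z] is set because [2 ^ m <= K]. *)
have gez : (2 ^ K <= z)%N.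
  by rewrite leqNgt; apply/negP => /bit_small; rewrite bitz// le_mK.
have ltKz : (K < z)%N by rewrite (leq_trans _ gez)// ltn_expl.
exists z; apply/seteqP; split => v; rewrite /unvisited /cball /= mdist_rado.
  case=> ltv vP; rewrite /rado_dist; case: eqP => _.
    by rewrite exprn_ge0// ltW.
  (* Only bit [v] of [z] matters: v < 2^(K+1) <= 2^z makes the converse bit vanish. *)
  have -> : rado z v = false.
    have -> : rado z v = bit z v.
      rewrite /rado (@bit_small v) ?orbF// (leq_trans ltv)// leq_exp2l//.
    have [leKv|ltvK] := ltnP K v.
      by rewrite bit_small// (leq_trans ltz)// leq_exp2l.
    by rewrite bitz//; have [ltvm /negbTE ->] := vP ltvK; rewrite leqNgt ltvm.
  by rewrite addr0 ler_weXn2l ?(ltW b1)// scale_le_small.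
move=> le_d; have ltv : (v < 2 ^ K.+1)%N.
  rewrite ltnNge; apply/negP => gev.
  have neq_zv : z != v by rewrite neq_ltn (leq_trans ltz gev).
  have : b ^+ scale z v <= b ^+ K.+1.
    by apply: le_trans le_d; exact: rado_dist_ge.
  by rewrite ler_eXn2l// leqNgt scale_ge// ltz.
split=> // levK; rewrite ltnNge; apply/andP; rewrite -negb_or -bitz//.
apply/negP => bit_zv; have ltvz := leq_ltn_trans levK ltKz.
move: le_d; rewrite /rado_dist /rado bit_zv gtn_eqF// leNgt => /negP; apply.
rewrite ltr_pwDr// ler_weXn2l ?(ltW b1)// scale_sym scale_ge// gez andbT.
by rewrite (leq_ltn_trans levK)// ltn_expl.
Qed.

Section AgainstAlgorithm.
Context (A : @strategy R X).

(** Determinism lets each new request react to all earlier positions. The starting point 0 counts as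
    visited. *)
Fixpoint adversary (t : nat) : seq (set X) :=
  if t is s.+1 then
    rcons (adversary s)
      (unvisited [seq positions A 0%N (adversary s) i | i <- iota 0 t])
  else [::].

Definition trajectory (t : nat) : X := positions A 0%N (adversary t) t.

Lemma adversaryS t : adversary t.+1 =
  rcons (adversary t)
    (unvisited [seq positions A 0%N (adversary t) i | i <- iota 0 t.+1]).
Proof. by []. Qed.

Lemma size_adversary t : size (adversary t) = t.
Proof. by elim: t => //= t IHt; rewrite size_rcons IHt. Qed.

Lemma take_adversary i t : (i <= t)%N -> take i (adversary t) = adversary i.
Proof.
elim: t => [|t IHt]; first by rewrite leqn0 => /eqP ->.
rewrite leq_eqVlt => /predU1P[->|lt_it].
  by rewrite take_oversize ?size_adversary.
by rewrite /= -cats1 takel_cat ?size_adversary// IHt.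
Qed.

(** A position depends only on the requests revealed so far, so the trajectory does not depend on
    the horizon. *)
Lemma positions_adversary i t : (i <= t)%N ->
  positions A 0%N (adversary t) i = trajectory i.
Proof. by case: i => // i le_it; rewrite /trajectory /positions !take_adversary. Qed.

Lemma nth_adversary i t : (i < t)%N ->
  nth set0 (adversary t) i = unvisited [seq trajectory j | j <- iota 0 i.+1].
Proof.
move=> lt_it; rewrite -(nth_take _ (ltnSn i)) take_adversary// adversaryS.
rewrite nth_rcons size_adversary ltnn eqxx; congr unvisited.
by apply/eq_in_map => j; rewrite mem_iota => ltj; rewrite positions_adversary.
Qed.

Lemma adversary_nested t : nested_requests (adversary t).
Proof.
rewrite /nested_requests /ball_requests size_adversary; split=> i lt_it.
  have [z eq_z] := unvisited_cball [seq trajectory j | j <- iota 0 i.+1].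
  by exists z, (b ^+ K.+1); rewrite nth_adversary// exprn_ge0// ltW.
rewrite !nth_adversary ?(ltnW lt_it)// => v [ltv vP].
split=> // /vP[ltvm notin]; split=> //.
apply: contra notin => /mapP[j]; rewrite mem_iota => ltj ->.
by apply: (@map_f nat nat); rewrite mem_iota; exact: ltnW.
Qed.

Context (A_online : online_algorithm (@nested_requests R X) A).

Lemma trajectory_unvisited t :
  unvisited [seq trajectory j | j <- iota 0 t.+1] (trajectory t.+1).
Proof.
have [_ /(_ t)] := A_online (0%N : X) (adversary_nested t.+1).
rewrite size_adversary ltnSn => /(_ isT).
by rewrite nth_adversary// positions_adversary.
Qed.

Lemma alg_costE t : alg_cost A (0%N : X) (adversary t) =
  \sum_(i < t) rado_dist b (trajectory i.+1) (trajectory i).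
Proof.
rewrite /alg_cost /movement size_adversary; apply: eq_bigr => i _.
by rewrite mdist_rado !positions_adversary// ltnW.
Qed.

(** Either the player escapes beyond [K], and the first such jump alone costs b^(a+1), or each of
    the [T] steps leads to a new point and costs at least 1. *)
Lemma adversary_cost T : T%:R <= b ^+ a.+1 ->
  T%:R <= alg_cost A (0%N : X) (adversary T).
Proof.
move=> leT; rewrite alg_costE.
have [ex_far|no_far] := pselect (exists t, (t <= T)%N && (K < trajectory t)%N).
  case: (ex_minnP ex_far) => -[|t] /andP[le_tT far_t] min_t.
    by move: far_t; rewrite /trajectory /= ltn0.
  apply: le_trans leT _; rewrite (bigD1 (Ordinal le_tT))//=.
  rewrite ler_wpDr ?sumr_ge0// => [i _|]; first by rewrite -mdist_rado mdist_ge0.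
  have near_t : (trajectory t <= K)%N.
    rewrite leqNgt; apply/negP => far; have := min_t t.
    by rewrite far ltnW//= ltnn => /(_ isT).
  have lt_t : (trajectory t < 2 ^ a)%N.
    apply: (@leq_trans (2 ^ m)); last by rewrite leq_exp2l.
    case: t near_t {le_tT far_t min_t} => [|t] near_t.
      by rewrite /trajectory expn_gt0.
    by have [_ /(_ near_t)[]] := trajectory_unvisited t.
  rewrite rado_dist_sym (le_trans _ (rado_dist_ge _ _))//.
    by rewrite ler_weXn2l ?(ltW b1)// scale_ge// lt_t ltnW.
  by rewrite neq_ltn (leq_ltn_trans near_t far_t).
rewrite -[T in leLHS]card_ord -sum1_card natr_sum ler_sum// => i _.
rewrite rado_dist_ge1//.
have [_ near] := trajectory_unvisited i.
have [|_] := near.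
  rewrite leqNgt; apply/negP => far; apply: no_far.
  by exists i.+1; rewrite far ltn_ord.
by apply: contra => /eqP ->; apply: (@map_f nat nat); rewrite mem_iota /=.
Qed.

Lemma offline_opt_ge0 t : 0 <= offline_opt (0%N : X) (adversary t).
Proof.
apply: lb_le_inf => [|_ [y _ <-]]; last first.
  by apply: sumr_ge0 => i _; exact: mdist_ge0.
(* The algorithm's own run witnesses that the set under the infimum is nonempty. *)
eexists; exists (positions A (0%N : X) (adversary t)); last by [].
exact: A_online (adversary_nested t).
Qed.

(** By pigeonhole some point [w] of the cluster avoids the [T] positions at times below [T]. Moving
    to [w] at once and staying there is feasible. *)
Lemma offline_opt_le T : (T < 2 ^ m)%N ->
  offline_opt (0%N : X) (adversary T) <= b ^+ m + 1.
Proof.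
move=> ltT; pose visited := [seq (trajectory j : nat) | j <- iota 0 T].
have [w ltw new_w] : exists2 w, (w < 2 ^ m)%N & w \notin visited.
  apply: contrapT => no_w; move: ltT; apply/negP; rewrite -leqNgt.
  have <- : size visited = T by rewrite size_map size_iota.
  rewrite -[leqLHS](size_iota 0).
  apply: uniq_leq_size (iota_uniq _ _) _ => w; rewrite mem_iota /= => ltw.
  by apply: contrapT => new_w; apply: no_w; exists w => //; apply/negP.
pose y t : X := if t is 0 then 0%N else w.
apply: (@le_trans _ _ (movement (size (adversary T)) y)).
  apply: ge_inf.
    by exists 0 => _ [z _ <-]; apply: sumr_ge0 => i _; exact: mdist_ge0.
  exists y => //; split=> // t; rewrite size_adversary => lt_tT.
  rewrite nth_adversary//; split=> [|_].
    apply: leq_trans ltw _; rewrite leq_exp2l//.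
    by rewrite (leq_trans le_ma)// ltnW// ltnS ltnW// ltn_expl.
  split=> //; apply: contra new_w => /mapP[j].
  rewrite mem_iota -[y t.+1]/w => ltj ->.
  by apply: (@map_f nat nat); rewrite mem_iota; exact: (leq_trans ltj).
rewrite /movement size_adversary; case: T {ltT visited new_w} => [|T].
  by rewrite big_ord0 addr_ge0// exprn_ge0// ltW.
rewrite big_ord_recl /= big1 ?addr0 => [|i _]; last by rewrite mdistxx.
rewrite mdist_rado (le_trans (rado_dist_le b1 _ _))// lerD2r.
by rewrite ler_weXn2l ?(ltW b1)// scale_le_small// expn_gt0.
Qed.

End AgainstAlgorithm.
End Adversary.

Lemma unbounded_ratio (A : @strategy R X) (M : R) : b < 2 -> 0 < M ->
  online_algorithm (@nested_requests R X) A ->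
  exists x0 Bs, nested_requests Bs /\
    (M%:E <= (alg_cost A x0 Bs)%:E / (offline_opt x0 Bs)%:E)%E.
Proof.
move=> b2 M0 A_online.
(* This choice gives 2^m - 1 > 2M b^m + b^m - 1 >= M (b^m + 1), as b^m >= 1. *)
have [|m ltm] := @exprn_unbounded R (2 / b) (2 * M + 1).
  by rewrite ltr_pdivlMr// mul1r.
pose T := (2 ^ m).-1.
(* The exponent [n] makes an escape from the cluster cost at least [T]. *)
have [n ltn] := exprn_unbounded T%:R b1.
pose a := maxn m n; have le_ma : (m <= a)%N := leq_maxl _ _.
have leT : T%:R <= b ^+ a.+1.
  by rewrite (le_trans (ltW ltn))// ler_weXn2l ?(ltW b1)// ltnW// ltnS leq_maxr.
have cost_ge := adversary_cost le_ma A_online leT.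
have ltT : (T < 2 ^ m)%N by rewrite /T prednK ?expn_gt0.
have opt_le := offline_opt_le le_ma A ltT.
have opt_ge0 := offline_opt_ge0 le_ma A_online T.
exists (0%N : X), (adversary m a A T); split; first exact: adversary_nested.
set cost := alg_cost _ _ _ in cost_ge *.
set opt := offline_opt _ _ in opt_le opt_ge0 *.
have T_ge : M * (b ^+ m + 1) <= T%:R.
  move: ltm; rewrite expr_div_n ltr_pdivlMr ?exprn_gt0// => ltm.
  have -> : T%:R = 2 ^+ m - 1 :> R.
    by rewrite -natrX -[in RHS](prednK (expn_gt0 2 m)) -natr1 addrK.
  have := exprn_ege1 m (ltW b1); move: ltm M0; nra.
have cost0 : 0 < cost.
  apply: lt_le_trans cost_ge; apply: lt_le_trans T_ge.
  by rewrite mulr_gt0// addr_gt0// exprn_gt0.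
rewrite inver; case: eqP => [_|/eqP opt_neq0].
  by rewrite gt0_muley ?lte_fin// leey.
rewrite -EFinM lee_fin ler_pdivlMr ?lt_def ?opt_neq0//.
apply: le_trans cost_ge; apply: le_trans T_ge.
by rewrite ler_pM2l.
Qed.

(** Keeping [adm] general treats the nested and the unrestricted problem at once. *)
Lemma opt_competitive_ratio_pinfty (adm : seq (set X) -> Prop) : b < 2 ->
  (forall Bs, nested_requests Bs -> adm Bs) ->
  opt_competitive_ratio adm = +oo%E.
Proof.
move=> b2 nested_adm; apply/ereal_inf_pinfty => _ [A A_online <-].
apply/eqyP => M M0; apply: le_ereal_sup_tmp.
have [|x0 [Bs [nestedBs ratio_ge]]] := unbounded_ratio b2 M0 (A := A).
  by move=> x0 Bs /nested_adm; exact: A_online.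
by eexists; [exists (x0, Bs) => //=; exact: nested_adm | exact: ratio_ge].
Qed.

End RadoChasing.

Theorem theorem1p6 (R : realType) :
  exists c : R, 0 < c /\
    forall rho : R, c <= rho ->
      exists X : metricType R,
        [/\ countable [set: X],
            assouad_dim X = rho%:E,
            chasing_ratio X = +oo%E
          & nested_chasing_ratio X = +oo%E].
Proof.
exists 2; split=> // rho rho2; have rho0 : 0 < rho by apply: lt_le_trans rho2.
pose b : R := 2 `^ rho^-1.
have b_rho : b `^ rho = 2 by rewrite -powRrM mulVf ?gt_eqF// powRr1.
have lt_powR (x y : R) : 0 <= x -> 0 <= y -> x `^ rho < y `^ rho -> x < y.
  move=> x0 y0; rewrite !ltNge; apply: contra => le_yx.
  by apply: ge0_ler_powR; rewrite ?nnegrE ?(ltW rho0).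
have b1 : 1 < b by apply: lt_powR; rewrite ?powR_ge0// powR1 b_rho ltr1n.
have b2 : b < 2.
  (* After raising to the power [rho], the claim is 2 < 2^rho, which follows from 2 < 2^2 <=
     2^rho. *)
  apply: lt_powR; rewrite ?powR_ge0// b_rho.
  apply: (@lt_le_trans _ _ (2 `^ 2%:R)); last by rewrite ler_powR// ler1n.
  by rewrite powR_mulrn// expr2; lra.
exists (rado_nat b1); split.
- exact: countableP.
- exact: rado_assouad_dim.
- by apply: opt_competitive_ratio_pinfty => // Bs [].
- exact: opt_competitive_ratio_pinfty.
Qed.
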